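(* Let $(X,d)$ be a contractible proper metric space and let $\overline X=X\sqcup Z$ be a controlled $\mathcal Z$-compactification of $(X,d)$. Let $\eta:[0,\infty)\to[0,\infty)$ be any monotone increasing function with $\lim_{r\to\infty}\eta(r)=\infty$. Then there is a $\mathcal Z$-compactification $\overline{X\times\mathbb R}$ of $X\times\mathbb R$ with boundary $\overline{X\times\mathbb R}\setminus (X\times\mathbb R)$ homeomorphic to $SZ$ satisfying the following control condition: for every open cover $\mathcal U$ of $\overline{X\times\mathbb R}$ there exist a compact set $Q\subseteq X$ and $N>0$ such that for every $k\in\mathbb Z$ and every $x\in X$, if $B_d[x,\eta(|k|)]\times[k,k+1]$ is disjoint from $Q\times[-N,N]$, then $B_d[x,\eta(|k|)]\times[k,k+1]\subseteq U$ for some $U\in\mathcal U$.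
   Context: $B_d[x,r]$ denotes the closed ball in $(X,d)$. A compactification $\overline Y$ of a proper metric space $(Y,d)$ is controlled if for every $R>0$ and every open cover $\mathcal U$ of $\overline Y$ there is a compact $C\subseteq Y$ such that every $A\subseteq Y\setminus C$ with $\operatorname{diam}_d(A)<R$ lies in some $U\in\mathcal U$. A closed $Z\subseteq Y$ is a $\mathcal Z$-set if there is a homotopy $\alpha:Y\times[0,1]\to Y$ with $\alpha_0=\mathrm{id}$ and $\alpha_t(Y)\subseteq Y\setminus Z$ for $t>0$; a compactification $\overline X$ of $X$ is a $\mathcal Z$-compactification if $\overline X\setminus X$ is a $\mathcal Z$-set in $\overline X$. A controlled $\mathcal Z$-compactification is one that is both. The suspension $SZ$ is $Z\times[-\infty,\infty]$ with $Z\times\{\infty\}$ and $Z\times\{-\infty\}$ each collapsed to a point. *)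

(* Defs.v *)
From HB Require Import structures.
From mathcomp Require Import all_boot all_order all_algebra.
From mathcomp Require Import all_classical all_reals all_analysis.
Set Implicit Arguments. Unset Strict Implicit. Unset Printing Implicit Defensive.
Import Order.TTheory GRing.Theory Num.Theory.
Import numFieldNormedType.Exports.
Local Open Scope classical_set_scope.
Local Open Scope ring_scope.

Definition cball {R : realType} {X : Type} (d : X -> X -> R) (x : X) (r : R) : set X :=
  [set y | d x y <= r].

Definition is_metric_for {R : realType} {X : topologicalType} (d : X -> X -> R) : Prop :=
  [/\ (forall x y, 0 <= d x y),
      (forall x y, d x y = 0 <-> x = y),
      (forall x y, d x y = d y x),
      (forall x y z, d x z <= d x y + d y z) &
      (forall A : set X, open A <->
         (forall x, A x -> exists2 e : R, 0 < e & [set y | d x y < e] `<=` A))].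

Definition proper_metric {R : realType} {X : topologicalType} (d : X -> X -> R) : Prop :=
  is_metric_for d /\ (forall x r, compact (cball d x r)).

Definition contractible {R : realType} (X : topologicalType) : Prop :=
  exists H : X * R -> X,
    [/\ {within [set: X] `*` `[0, 1]%classic, continuous H},
        (forall x, H (x, 0) = x) &
        exists x0 : X, forall x, H (x, 1) = x0].

Definition is_compactification {Y W : topologicalType} (e : Y -> W) : Prop :=
  [/\ compact [set: W], hausdorff_space W, injective e, continuous e &
      (forall U : set Y, open U ->
          exists2 O : set W, open O & e @` U = O `&` range e)] /\
  closure (range e) = [set: W].

Definition remainder {Y W : Type} (e : Y -> W) : set W := ~` range e.

Definition Zset {R : realType} {W : topologicalType} (Z : set W) : Prop :=
  closed Z /\
  exists alpha : W * R -> W,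
    [/\ {within [set: W] `*` `[0, 1]%classic, continuous alpha},
        (forall w, alpha (w, 0) = w) &
        (forall w t, 0 < t <= 1 -> ~ Z (alpha (w, t)))].

Definition is_Zcompactification {R : realType} {Y W : topologicalType} (e : Y -> W) : Prop :=
  is_compactification e /\ Zset (R := R) (remainder e).

Definition diam_lt {R : realType} {X : Type} (d : X -> X -> R) (A : set X) (r : R) : Prop :=
  exists2 s : R, s < r & forall a b, A a -> A b -> d a b <= s.

Definition open_cover {W : topologicalType} (U : set (set W)) : Prop :=
  (forall V, U V -> open V) /\ \bigcup_(V in U) V = [set: W].

Definition controlled {R : realType} {Y W : topologicalType} (d : Y -> Y -> R) (e : Y -> W) : Prop :=
  forall (r : R) (U : set (set W)), 0 < r -> open_cover U ->
    exists2 C : set Y, compact C &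
      forall A : set Y, A `<=` ~` C -> diam_lt d A r ->
        exists2 V, U V & e @` A `<=` V.

Definition rel_open {T : topologicalType} (S A : set T) : Prop :=
  exists2 O : set T, open O & A `&` S = O `&` S.

(* The subspace B of W is homeomorphic to the (unreduced) suspension
   SZ = (Z x [-oo,+oo]) with Z x {+oo} and Z x {-oo} collapsed to points
   (the two cone points n, s), Z a subspace of V.  This is phrased as:
   q together with the poles is a quotient map onto B whose fibres are
   exactly the classes of the suspension relation. *)
Definition homeomorphic_to_suspension {R : realType} {V W : topologicalType}
    (Z : set V) (B : set W) : Prop :=
  exists (q : V * \bar R -> W) (n s : W),
    [/\ B n, B s, n <> s,
        (forall z t, Z z -> B (q (z, t))) &
        (forall z, Z z -> q (z, +oo%E) = n /\ q (z, -oo%E) = s)] /\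
    [/\
        (forall b, B b -> b = n \/ b = s \/ exists2 z, Z z & exists r : R, b = q (z, r%:E)),
        (forall z z' (r r' : R), Z z -> Z z' -> q (z, r%:E) = q (z', r'%:E) -> z = z' /\ r = r'),
        (forall z (r : R), Z z -> q (z, r%:E) <> n /\ q (z, r%:E) <> s) &
        (forall A : set W, A `<=` B ->
           (rel_open B A <-> rel_open (Z `*` [set: \bar R]) (q @^-1` A)))].

(* Main.v *)
(** The compactification is the suspension [SXb] of [Xb], and [X x R] sits in
    it through [(x, r) |-> (x, r / p x)], where [p] is a very slowly growing
    proper function of [d x1 x]. For a box over [B[x, eta |k|]] containing a
    point of bounded slope, [|k|] is at most a multiple of [p]; since [p] grows
    slowly, [eta |k|] is negligible compared with the distance to [x1], so [p]
    is almost constant on the box and, by the control of [Xb], the box is small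
    in the [Xb] direction. Boxes without points of bounded slope are close to a
    pole. To choose one [p] for all covers, only countably many
    covers of [Xb] may matter: the maps [alpha_(1/m) : Xb -> X] provided by the
    Z-set homotopy pull the metric of [X] back to a separating sequence of
    pseudometrics. The contractibility of [X] is what makes the homotopy that
    pushes [SXb] off [SZ] well defined at the poles. *)

Require Import Defs.
From HB Require Import structures.
From mathcomp Require Import all_boot all_order all_algebra.
From mathcomp Require Import all_classical all_reals all_analysis.
From mathcomp Require Import ring lra.
Import Order.TTheory GRing.Theory Num.Theory.
Import numFieldNormedType.Exports.
Local Open Scope classical_set_scope.
Local Open Scope ring_scope.
Set Implicit Arguments. Unset Strict Implicit. Unset Printing Implicit Defensive.

(* The suspension of [V], with [R] as suspension coordinate away from the two
   poles; [Pole true] is the pole at +oo. *)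
Inductive susp (V R : Type) : Type := Spt (w : V) (s : R) | Pole (b : bool).
Arguments Spt {V R} w s.
Arguments Pole {V R} b.

Definition sgn {R : realType} (b : bool) : R := if b then 1 else -1.

Lemma sgn_mulK {R : realType} (b : bool) (s : R) : sgn b * (sgn b * s) = s.
Proof. by rewrite /sgn; case: b; rewrite ?mul1r // !mulN1r opprK. Qed.

Lemma normr_sgn {R : realType} (b : bool) (s : R) : `|sgn b * s| = `|s|.
Proof. by rewrite /sgn; case: b; rewrite ?mul1r // mulN1r normrN. Qed.

(** * The suspension topology *)

Section suspension.
Context {V : topologicalType} {R : realType}.
Local Notation S := (susp V R).

HB.instance Definition _ := gen_eqMixin S.
HB.instance Definition _ := gen_choiceMixin S.

Definition spt (p : V * R) : S := Spt p.1 p.2.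

Definition susp_nbhs (x : S) : set_system S :=
  match x with
  | Spt w s => spt @ nbhs (w, s)
  | Pole b => [set U | U (Pole b) /\
                 \forall s \near +oo, forall w, U (Spt w (sgn b * s))]
  end.

Let susp_filter (x : S) : ProperFilter (susp_nbhs x).
Proof.
case: x => [w s|b]; first exact: fmap_proper_filter.
apply: Build_ProperFilter_ex; first by move=> U [Ub _]; exists (Pole b).
split => /=.
- by split => //; apply: nearW.
- move=> P Q [Pb Pn] [Qb Qn]; split; first by [].
  by near=> s => w; split; [exact: (near Pn s)|exact: (near Qn s)].
- move=> P Q PQ [Pb Pn]; split; first exact: PQ.
  by near=> s => w; apply: PQ; exact: (near Pn s).
Unshelve. all: by end_near. Qed.

Let susp_singleton (x : S) U : susp_nbhs x U -> U x.
Proof. by case: x => [w s /nbhs_singleton|b []]. Qed.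

Let susp_nbhs_nbhs (x : S) (U : set S) :
  susp_nbhs x U -> susp_nbhs x (susp_nbhs^~ U).
Proof.
case: x => [w s|b].
  move=> Uw; have /nbhs_interior := Uw : nbhs (w, s) (spt @^-1` U).
  suff : (spt @^-1` U)° `<=` spt @^-1` (susp_nbhs^~ U) by exact: filterS.
  by case.
move=> [Ub Un]; split; first by split.
case: Un => M [Mr UM]; near=> s => w.
change (nbhs (w, sgn b * s) (spt @^-1` U)).
have Ms : M < s by near: s; apply: nbhs_pinfty_gt.
(* The half space beyond [M] is open, so it is a neighbourhood of each of its points. *)
have : \forall p \near (w, sgn b * s), M < sgn b * p.2.
  have : (sgn b * p.2) @[p --> (w, sgn b * s)] --> sgn b * (sgn b * s).
    by apply: cvgM; [exact: cvg_cst|exact: cvg_snd].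
  by rewrite sgn_mulK => /cvgr_gt; exact.
apply: filterS => -[w' s'] /= H.
by rewrite /spt /= -(sgn_mulK b s'); apply: UM.
Unshelve. all: by end_near. Qed.

HB.instance Definition _ := hasNbhs.Build S susp_nbhs.

HB.instance Definition _ := @Nbhs_isNbhsTopological.Build S
  susp_filter susp_singleton susp_nbhs_nbhs.

Lemma spt_continuous : continuous spt.
Proof. by move=> [w s]. Qed.

Lemma nbhs_spt w s (U : set S) : nbhs (Spt w s) U = nbhs (w, s) (spt @^-1` U).
Proof. by []. Qed.

Lemma open_image_spt (U : set (V * R)) : open U -> open (spt @` U).
Proof.
rewrite !openE => oU _ [[w s] Us <-].
rewrite /interior nbhs_spt; apply: filterS (oU _ Us) => p Up; by exists p.
Qed.

Lemma spt_inj : injective spt.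
Proof. by move=> [w s] [w' s'] []/= -> ->. Qed.

(** The two poles take care of all points with [|s|] beyond some common bound [M]; what remains is
    the compact product of [V] with [[-M, M]]. *)
Lemma compact_susp : compact [set: V] -> compact [set: S].
Proof.
move=> cV; apply/compact_near_coveringP => I F P FF FT.
have polP b : \forall M \near +oo & i \near F,
    P i (Pole b) /\ forall w s, M < sgn b * s -> P i (Spt w s).
  have [[U G] /= [[Ub [M [Mr UM]]] FG] UGP] := FT (Pole b) Logic.I.
  exists ([set N | M < N], G) => //=.
    by split=> //; apply: nbhs_pinfty_gt.
  move=> [N i] /= [MN Gi]; split; first exact: (UGP (_, _)).
  move=> w s Ns; apply: (UGP (_, _)); split => //=.
  by rewrite -(sgn_mulK b s); apply: UM; apply: lt_trans Ns.
have [[A1 G1] /= [A1M FG1] P1] := polP true.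
have [[A2 G2] /= [A2M FG2] P2] := polP false.
have [M [M1 M2]] : exists M, A1 M /\ A2 M.
  have : \forall M \near +oo, A1 M /\ A2 M by apply: filterI.
  by move/filter_ex.
have cK : compact ([set: V] `*` `[-M, M]%classic).
  by apply: compact_setX => //; exact: segment_compact.
have cov : \near F, ([set: V] `*` `[-M, M]%classic) `<=` (fun p => P F (spt p)).
  move/compact_near_coveringP: cK; apply => -[w s] _.
  have [[U G] /= [Uw FG] UGP] := FT (Spt w s) Logic.I.
  exists (spt @^-1` U, G) => //= -[p i] /= [Up Gi].
  exact: (UGP (_, _)).
near=> i.
have Gi1 : G1 i by near: i.
have Gi2 : G2 i by near: i.
have covi := near cov i.
move=> -[w s|b] _.
- have [Ms|sM] := ltP M s.
    have [_ /(_ w s)] := P1 (M, i) (conj M1 Gi1).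
    by rewrite /sgn mul1r; apply.
  have [Ms|Ms] := ltP s (- M).
    have [_ /(_ w s)] := P2 (M, i) (conj M2 Gi2).
    by rewrite /sgn mulN1r; apply; rewrite // ltrNr.
  by apply: (covi _ (w, s)) => //=; split => //=; rewrite in_itv /= Ms.
- by case: b; [have [] := P1 (M, i) (conj M1 Gi1)
             |have [] := P2 (M, i) (conj M2 Gi2)].
Unshelve. all: by end_near. Qed.

(** A point of coordinate [s] is separated from a pole by the level [|s| + 1], the two poles by the
    sign of the coordinate, and two ordinary points coordinatewise. *)
Lemma hausdorff_susp : hausdorff_space V -> hausdorff_space S.
Proof.
move=> hV.
have sep b w s : ~ cluster (nbhs (Pole b : S)) (Spt w s).
  move=> /(_ [set x | if x is Spt _ s' then `|s| + 1 < `|s'| else True]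
             [set x | if x is Spt _ s' then `|s'| < `|s| + 1 else False]).
  case.
  - split => //; near=> s' => w' /=; rewrite normr_sgn.
    apply: lt_le_trans (ler_norm _).
    by near: s'; apply: nbhs_pinfty_gt; rewrite num_real.
  - rewrite nbhs_spt.
    have : `|p.2| @[p --> (w, s)] --> `|s| by apply: cvg_norm; exact: cvg_snd.
    by move=> /cvgr_lt; apply; rewrite ltrDl.
  - move=> x; case: x => [w' s'|b'] [] //= h1 h2.
    by move: (lt_trans h1 h2); rewrite ltxx.
move=> [w s|b] [w' s'|b'].
- move=> clu; congr Spt.
    apply: hV => A B Aw Bw.
    have nA : nbhs (Spt w s : S) (spt @` (fst @^-1` A)).
      have : nbhs (w, s) (fst @^-1` A) by exact: cvg_fst.
      rewrite nbhs_spt; apply: filterS => p; by exists p.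
    have nB : nbhs (Spt w' s' : S) (spt @` (fst @^-1` B)).
      have : nbhs (w', s') (fst @^-1` B) by exact: cvg_fst.
      rewrite nbhs_spt; apply: filterS => p; by exists p.
    have [_ [[x Ax <-] [y By /spt_inj yx]]] := clu _ _ nA nB.
    by exists x.1; split => //; rewrite -yx.
  apply: (@Rhausdorff R) => A B As Bs.
  have nA : nbhs (Spt w s : S) (spt @` (snd @^-1` A)).
    have : nbhs (w, s) (snd @^-1` A) by exact: cvg_snd.
    rewrite nbhs_spt; apply: filterS => p; by exists p.
  have nB : nbhs (Spt w' s' : S) (spt @` (snd @^-1` B)).
    have : nbhs (w', s') (snd @^-1` B) by exact: cvg_snd.
    rewrite nbhs_spt; apply: filterS => p; by exists p.
  have [_ [[x Ax <-] [y By /spt_inj yx]]] := clu _ _ nA nB.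
  by exists x.2; split => //; rewrite -yx.
- by move=> clu; case: (sep b' w s) => A B /clu AB /AB; rewrite setIC.
- by move=> /sep.
- move=> clu; congr Pole; apply/eqP/negP => /negP bb'.
  pose N (a : bool) : set S :=
    [set x | if x is Spt _ t then 0 < sgn a * t else x = Pole a].
  have nN a : nbhs (Pole a : S) (N a).
    split => //; near=> s => w /=; rewrite sgn_mulK; near: s.
    exact: nbhs_pinfty_gt.
  have [[w s|b''] []] := clu _ _ (nN b) (nN b').
    by move: bb'; case: b {clu}; case: b' => //= _; rewrite /sgn; lra.
  by rewrite /N /= => -> [] /eqP; rewrite (negbTE bb').
Unshelve. all: by end_near. Qed.

End suspension.

(** * A slowly growing function *)

Section slow_function.
Context {R : realType} (G : nat -> R).

(* [slow] grows by one between consecutive breakpoints; the gaps are chosen so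
   that moving by [G n] from a point of value about [n] crosses at most one
   breakpoint and stays above [G n]. *)
Fixpoint breakpoint (n : nat) : R :=
  if n is k.+1 then
    breakpoint k + k.+1%:R + 2 * `|G k.+3| + `|G k.+1|
  else 0.

Definition slow_term (t : R) (n : nat) : R :=
  n%:R + 1 + Num.max 0 (t - breakpoint n).

(** Lower envelope of ramps, the [n]-th one being constant [n + 1] up to [breakpoint n] and of slope
    one afterwards. An infimum of 1-Lipschitz functions is 1-Lipschitz, which yields continuity for
    any [G]. *)
Definition slow (t : R) : R := inf (range (slow_term t)).

Lemma slow_term_ge1 t n : 1 <= slow_term t n.
Proof.
have n0 : 0 <= n%:R :> R by [].
have m0 : 0 <= Num.max 0 (t - breakpoint n) by rewrite le_max lexx.
by rewrite /slow_term; lra.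
Qed.

Lemma slow_le t n : slow t <= slow_term t n.
Proof.
by apply: ge_inf; [exists 1 => _ [k _ <-]; exact: slow_term_ge1|exists n].
Qed.

Lemma le_slow t a : (forall n, a <= slow_term t n) -> a <= slow t.
Proof.
move=> h; apply: lb_le_inf; first by exists (slow_term t 0), 0%N.
by move=> _ [k _ <-].
Qed.

Lemma slow_ge1 t : 1 <= slow t.
Proof. by apply: le_slow => n; exact: slow_term_ge1. Qed.

Lemma slow_lipschitz s t : `|slow s - slow t| <= `|s - t|.
Proof.
have h a b : slow a <= slow b + `|a - b|.
  rewrite -lerBlDr; apply: le_slow => n; rewrite lerBlDr.
  apply: le_trans (slow_le a n) _; rewrite /slow_term -!addrA !lerD2l.
  rewrite ge_max addr_ge0 ?le_max ?lexx //=.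
  have := ler_norm (a - b).
  have : b - breakpoint n <= Num.max 0 (b - breakpoint n).
    by rewrite le_max lexx orbT.
  lra.
by have := h s t; have := h t s; rewrite (distrC t s) ler_norml; lra.
Qed.

Lemma breakpoint_ge0 n : 0 <= breakpoint n.
Proof. by elim: n => //= n ih; rewrite !addr_ge0 // mulr_ge0. Qed.

Lemma breakpoint_homo m n : (m <= n)%N -> breakpoint m <= breakpoint n.
Proof.
elim: n => [|n ih]; first by rewrite leqn0 => /eqP ->.
rewrite leq_eqVlt => /orP[/eqP -> //|]; rewrite ltnS => /ih /le_trans; apply.
by rewrite /= -!addrA lerDl !addr_ge0 // mulr_ge0.
Qed.

Lemma slow_le_breakpoint t n : t <= breakpoint n -> slow t <= n%:R + 1.
Proof.
move=> tn; apply: le_trans (slow_le t n) _; rewrite /slow_term.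
by have /max_l -> : t - breakpoint n <= 0; lra.
Qed.

(** Once [t] reaches [breakpoint n + n.+1], every ramp is at least [n + 2]: those of index above [n]
    by their constant part, the others because they have been rising since [breakpoint n] at the
    latest. *)
Lemma slow_lt_breakpoint t n : slow t < n.+1%:R + 1 ->
  t < breakpoint n + n.+1%:R.
Proof.
move=> tn; rewrite ltNge; apply/negP => nt; move: tn; apply/negP.
rewrite -leNgt; apply: le_slow => m; rewrite /slow_term.
have m0 : 0 <= Num.max 0 (t - breakpoint m) by rewrite le_max lexx.
have [nm|mn] := ltnP n m.
  have : n.+1%:R <= m%:R :> R by rewrite ler_nat.
  lra.
have := breakpoint_homo mn.
have : t - breakpoint m <= Num.max 0 (t - breakpoint m).
  by rewrite le_max lexx orbT.
have : 0 <= m%:R :> R by [].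
lra.
Qed.

Lemma slow_variation n t t' : (3 <= n)%N -> n%:R <= slow t < n.+1%:R ->
  `|t' - t| <= G n -> `|slow t' - slow t| <= 2 /\ G n <= t'.
Proof.
case: n => [|[|[|k]]] // _ /andP[nt tn]; rewrite ler_norml => /andP[t1 t2].
have Gge : G k.+3 <= `|G k.+3| := ler_norm _.
have e1 : k.+1%:R = k%:R + 1 :> R by rewrite -natr1.
have e2 : k.+2%:R = k%:R + 2 :> R by rewrite -natr1 e1; lra.
have e3 : k.+3%:R = k%:R + 3 :> R by rewrite -natr1 e2; lra.
have e4 : k.+4%:R = k%:R + 4 :> R by rewrite -natr1 e3; lra.
have k0 : 0 <= k%:R :> R by [].
have b0 := breakpoint_ge0 k.
have g1 : 0 <= `|G k.+1| by [].
have g3 : 0 <= `|G k.+3| by [].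
have g5 : 0 <= `|G k.+3.+2| by [].
have t_gt : breakpoint k.+1 < t.
  by rewrite ltNge; apply/negP => /slow_le_breakpoint; lra.
have t_lt : t < breakpoint k.+2 + k.+3%:R by apply: slow_lt_breakpoint; lra.
have up : slow t' <= k.+3%:R + 1.
  by apply: slow_le_breakpoint; move: t_lt => /=; lra.
have lo : k.+2%:R <= slow t'.
  rewrite leNgt; apply/negP => lt2.
  have : t' < breakpoint k + k.+1%:R by apply: slow_lt_breakpoint; lra.
  by move: t_gt => /=; lra.
split; first by rewrite ler_norml; lra.
by move: t_gt => /=; lra.
Qed.

Lemma slow_proper t n : slow t <= n%:R -> t <= breakpoint n + n.+1%:R.
Proof.
move=> tn; apply/ltW/slow_lt_breakpoint; apply: le_lt_trans tn _.
by rewrite -natr1; lra.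
Qed.

End slow_function.

(** * A countable base of covers from a separating sequence of maps *)

Section left_inverse.
Context {Y W : topologicalType} (e : Y -> W) (y0 : Y).

(** Off the range of [e] the value is the default [y0]; continuity is claimed only at points of the
    range. *)
Definition left_inv (w : W) : Y := xget y0 [set y | e y = w].

Lemma left_inv_range w : range e w -> e (left_inv w) = w.
Proof.
case=> y _ yw; have yP : [set x | e x = w] y by [].
exact: (xgetI y0 yP).
Qed.

Lemma left_invK : injective e -> cancel e left_inv.
Proof. by move=> einj y; apply/einj/left_inv_range; exists y. Qed.

Lemma left_inv_continuous : injective e -> open (range e) ->
  (forall U : set Y, open U ->
     exists2 O : set W, open O & e @` U = O `&` range e) ->
  forall w, range e w -> {for w, continuous left_inv}.
Proof.
move=> einj ran_open eop w ew U /= Uw.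
have [P oP imP] := eop _ (open_interior U).
have : (P `&` range e) w.
  by rewrite -imP; exists (left_inv w); [exact: Uw|exact: left_inv_range].
move=> [Pw _].
have : nbhs w (P `&` range e) by apply: open_nbhs_nbhs; split; [exact: openI|].
rewrite -imP => nw; change (nbhs w (left_inv @^-1` U)).
apply: filterS nw => _ [y Uy <-] /=.
by rewrite left_invK //; exact: interior_subset.
Qed.

End left_inverse.

(** * Distance functions of a metric space *)

Section metric_facts.
Context {R : realType} {X : topologicalType} (d : X -> X -> R).
Hypothesis dmet : is_metric_for d.

Lemma near_dist_lt x (r : R) : 0 < r -> \forall y \near x, d x y < r.
Proof.
case: dmet => d0 dE dC dT dop r0; apply: open_nbhs_nbhs; split.
  apply/dop => y /= xy; exists (r - d x y); first by rewrite subr_gt0.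
  by move=> z /= yz; have := dT x y z; lra.
by have /dE : x = x by []; move=> /= ->.
Qed.

Lemma ler_dist_dist x y z : `|d x y - d x z| <= d y z.
Proof.
case: dmet => d0 dE dC dT dop; rewrite ler_norml.
by have := dT x y z; have := dT x z y; rewrite (dC z y); lra.
Qed.

Lemma dist_continuous x : continuous (d x).
Proof.
move=> y; apply/cvgrPdist_lt => r r0.
by apply: filterS (near_dist_lt y r0) => z; apply: le_lt_trans; exact: ler_dist_dist.
Qed.

Lemma compact_dist_bounded x (C : set X) : compact C ->
  exists2 c : R, 0 <= c & forall y, C y -> d x y <= c.
Proof.
move=> /compact_near_coveringP cC.
have : \forall c \near +oo, C `<=` (fun y => d x y <= c).
  apply: cC => y _.
  exists ([set z | d x z < d x y + 1], [set c | d x y + 1 < c]) => /=.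
    split; last by apply: nbhs_pinfty_gt; rewrite num_real.
    by have /cvgr_lt := @dist_continuous x y; apply; rewrite ltrDl.
  by move=> [z c] /= [zy yc]; apply/ltW/(lt_trans zy).
move=> /(filterI (nbhs_pinfty_ge (num_real 0))) /filter_ex[c [c0 cb]].
by exists c.
Qed.

End metric_facts.

(** * Closeness relations on a compact space given by a separating sequence of maps *)

Section separating_sequence.
Context {R : realType} {X T : topologicalType} (d : X -> X -> R)
  (beta : nat -> T -> X).
Hypothesis dmet : is_metric_for d.
Hypothesis bcont : forall m, continuous (beta m).
Hypothesis bsep : forall a b, (forall m, beta m a = beta m b) -> a = b.
Hypothesis Tcomp : compact [set: T].

(** The single index governs both the number of maps and the tolerance, so the relations shrink as
    [n] grows and one sequence suffices to test all covers. *)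
Definition close (n : nat) (a b : T) : Prop :=
  forall m, (m <= n)%N -> d (beta m a) (beta m b) <= n.+1%:R^-1.

Lemma near_close_lt w n (r : R) : 0 < r ->
  \forall a \near w, forall m, (m <= n)%N -> d (beta m w) (beta m a) < r.
Proof.
move=> r0; have h m : \forall a \near w, d (beta m w) (beta m a) < r.
  exact: (@bcont m w _ (near_dist_lt dmet (beta m w) r0)).
elim: n => [|n ih]; first by apply: filterS (h 0) => a ? m; rewrite leqn0 => /eqP ->.
apply: filterS2 ih (h n.+1) => a H1 H2 m.
by rewrite leq_eqVlt => /orP[/eqP -> //|]; rewrite ltnS; exact: H1.
Qed.

(** Each point [b] off the interior of [A] is told apart from [w] by some [beta m]. Half the
    distance of the two images works for all points near [b], and compactness makes [n] uniform. *)
Lemma close_nbhs w (A : set T) : nbhs w A ->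
  exists n, forall a, close n w a -> A a.
Proof.
case: dmet => d0 dE dC dT dop Aw.
have cK : compact (~` A°).
  by apply: (subclosed_compact _ Tcomp) => //; apply/open_closedC/open_interior.
suff /filter_ex[n Hn] : \forall n \near \oo, ~` A° `<=` (fun a => ~ close n w a).
  exists n => a wa; apply: interior_subset; apply: contrapT => /Hn; exact.
move/compact_near_coveringP : cK; apply => b nAb.
have [m mb] : exists m, beta m w <> beta m b.
  apply: contrapT => /forallNP h; apply: nAb.
  suff -> : b = w by exact: Aw.
  by apply: bsep => m; have := h m; rewrite notE => ->.
have dpos : 0 < d (beta m w) (beta m b).
  by rewrite lt_neqAle d0 andbT eq_sym; apply/eqP => /dE.
set r := d _ _ in dpos.
have r2 : 0 < r / 2 by lra.
exists ([set b' | d (beta m b) (beta m b') < r / 2],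
        [set n | (m <= n)%N /\ n.+1%:R^-1 < r / 2]) => /=.
  split; first exact: (@bcont m b _ (near_dist_lt dmet _ r2)).
  apply: filterI; first exact: nbhs_infty_ge.
  exact: (near_infty_natSinv_lt (PosNum r2)).
move=> [b' n] /= [bb' [mn nr]] /(_ m mn) H.
have := dT (beta m w) (beta m b') (beta m b); rewrite (dC (beta m b')) -/r.
by have := le_lt_trans H nr; lra.
Qed.

Definition close_cover (n : nat) : set (set T) :=
  [set V | open V /\ forall a b, V a -> V b -> close n a b].

Lemma open_close_cover n : open_cover (close_cover n).
Proof.
case: dmet => d0 dE dC dT dop; split; first by move=> V [].
rewrite -subTset => w _.
pose r : R := n.+1%:R^-1 / 2.
have r0 : 0 < r by rewrite divr_gt0 // invr_gt0.
have wr := near_close_lt w n r0.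
exists ([set a | forall m, (m <= n)%N -> d (beta m w) (beta m a) < r]°) => //.
split; first exact: open_interior.
move=> a b /interior_subset aw /interior_subset bw m mn.
have := aw m mn; have := bw m mn.
have -> : n.+1%:R^-1 = r + r :> R by rewrite /r -splitr.
by have := dT (beta m a) (beta m w) (beta m b); rewrite (dC _ (beta m w)); lra.
Qed.

(** A Lebesgue number for the part of the suspension of bounded coordinate, obtained from
    compactness of [T x [-M, M]]. *)
Lemma close_refines (U : set (set (susp T R))) (M : R) : open_cover U ->
  \forall n \near \oo, forall w s, -M <= s <= M ->
    exists2 V, U V &
      forall w' s', close n w w' -> `|s - s'| < n.+1%:R^-1 -> V (Spt w' s').
Proof.
case: dmet => d0 dE dC dT dop [Uo Uc].
suff H : \forall n \near \oo, [set: T] `*` `[-M, M]%classic `<=`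
    (fun p => exists2 V, U V & forall w' s', close n p.1 w' ->
       `|p.2 - s'| < n.+1%:R^-1 -> V (Spt w' s')).
  apply: filterS H => n Hn w s Ms; apply: (Hn (w, s)).
  by split => //=; rewrite in_itv.
have /compact_near_coveringP : compact ([set: T] `*` `[-M, M]%classic).
  by apply: compact_setX => //; exact: segment_compact.
apply => -[w s] _.
have [V UV Vws] : (\bigcup_(V in U) V) (Spt w s) by rewrite Uc.
have : nbhs (Spt w s) V by apply: open_nbhs_nbhs; split; [exact: Uo|].
rewrite nbhs_spt => -[[A B] /= [Aw Bs] ABV].
have [k kA] := close_nbhs Aw.
have /nbhs_ballP[r /= r0 rB] := Bs.
(* Half the tolerance of [close k]: one half goes from [w] to the nearby point [a], the other from
   [a] to [w']. The coordinate uses [r / 2] in the same way. *)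
pose q : R := k.+1%:R^-1 / 2.
have q0 : 0 < q by rewrite divr_gt0 // invr_gt0.
have r2 : 0 < r / 2 by lra.
exists ([set a | (forall m, (m <= k)%N -> d (beta m w) (beta m a.1) < q) /\
                 `|s - a.2| < r / 2],
        [set n | [/\ (k <= n)%N, n.+1%:R^-1 < q & n.+1%:R^-1 < r / 2]]) => /=.
  split.
    exists ([set a | forall m, (m <= k)%N -> d (beta m w) (beta m a) < q],
            ball s (r / 2)) => /=; last by move=> [].
    by split; [exact: near_close_lt|exact: nbhsx_ballx].
  have h1 := near_infty_natSinv_lt (PosNum q0).
  have h2 := near_infty_natSinv_lt (PosNum r2).
  by apply: filterS3 (nbhs_infty_ge k) h1 h2 => n.
move=> [[a t] n] /= [[aw st] [kn nq nr]]; exists V => // w' s' aw' ts'.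
apply: (ABV (w', s')); split => /=.
  apply: kA => m mk; have := aw m mk; have := aw' m (leq_trans mk kn).
  have -> : k.+1%:R^-1 = q + q :> R by rewrite /q -splitr.
  move=> /le_lt_trans /(_ nq).
  by have := dT (beta m w) (beta m a) (beta m w'); lra.
apply: rB; rewrite /ball /=; have := lt_trans ts' nr; have := ler_normD (s - t) (t - s').
by rewrite (_ : s - t + (t - s') = s - s'); [lra|ring].
Qed.

End separating_sequence.

(** * The compactification and its boundary *)

Lemma cvg_pairT {T : Type} {U V : topologicalType} {F : set_system T}
    {FF : Filter F} (f : T -> U) (g : T -> V) (a : U) (b : V) :
  f @ F --> a -> g @ F --> b -> (f x, g x) @[x --> F] --> (a, b).
Proof.
move=> fa gb A [[B C] /= [Ba Cb] BCA].
have FB : F (f @^-1` B) := fa _ Ba.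
have FC : F (g @^-1` C) := gb _ Cb.
change (F (fun x => A (f x, g x))).
by apply: filterS2 FB FC => x Bx Cx; exact: (BCA (_, _)).
Qed.

Section suspension_compactification.
Context {R : realType} {X Xb : topologicalType} (i : X -> Xb)
  (p : X -> R) (x0 : X).
Hypothesis icomp : is_compactification i.
Hypothesis iopen : open (range i).
Hypothesis p_cont : continuous p.
Hypothesis p_gt0 : forall x, 0 < p x.
Local Notation W := (susp Xb R).

Definition slope_embed (q : X * R) : W := Spt (i q.1) (q.2 / p q.1).
Local Notation j := slope_embed.

Lemma slope_embed_inj : injective j.
Proof.
case: icomp => -[_ _ iinj _ _] _ [x r] [y s] [] /= /iinj -> /divIf -> //.
by rewrite gt_eqF.
Qed.

Lemma slope_embed_continuous : continuous j.
Proof.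
case: icomp => -[_ _ _ icont _] _ q.
have h : (i u.1, u.2 / p u.1) @[u --> q] --> (i q.1, q.2 / p q.1).
  apply: cvg_pairT => /=.
    by apply: (continuous_comp (f := fst)); [exact: cvg_fst|exact: icont].
  apply: cvgM; first exact: cvg_snd.
  apply: cvgV; first by rewrite gt_eqF.
  by apply: (continuous_comp (f := fst)); [exact: cvg_fst|exact: p_cont].
exact: (cvg_comp _ _ h (@spt_continuous _ _ _)).
Qed.

Lemma slope_embed_open (U : set (X * R)) : open U -> open (j @` U).
Proof.
case: icomp => -[_ _ iinj icont irel] _ oU.
pose l := left_inv i x0.
(* The image is a preimage under the inverse [(w, s) |-> (l w, s * p (l w))], which is continuous
   over the open set [range i]. *)
have -> : j @` U =
    spt @` [set v | range i v.1 /\ U (l v.1, v.2 * p (l v.1))].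
  apply/seteqP; split => [_ [[x r] Uxr <-]|_ [[w s] [/= wi Uw] <-]].
    exists (i x, r / p x) => //=; split; first by exists x.
    by rewrite /l left_invK // divfK // gt_eqF.
  exists (l w, s * p (l w)) => //.
  by rewrite /j /spt /= /l left_inv_range // mulfK // gt_eqF.
apply: open_image_spt; rewrite openE => v [vi Uv].
have lv : (l u.1) @[u --> v] --> l v.1.
  apply: (continuous_comp (f := fst)); first exact: cvg_fst.
  exact: left_inv_continuous.
have h : (l u.1, u.2 * p (l u.1)) @[u --> v] --> (l v.1, v.2 * p (l v.1)).
  apply: cvg_pairT; first exact: lv.
  apply: cvgM; first exact: cvg_snd.
  by apply: continuous_cvg; [exact: p_cont|exact: lv].
apply: filterI; last by apply: h; exact: open_nbhs_nbhs.
have : nbhs v.1 (range i) by exact: open_nbhs_nbhs.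
exact: (@cvg_fst _ _ (nbhs v.1) (nbhs v.2)).
Qed.

Lemma slope_embed_compactification : is_compactification j.
Proof.
case: icomp => -[cXb hXb iinj icont irel] dense_i.
split; first split.
- exact: compact_susp.
- exact: hausdorff_susp.
- exact: slope_embed_inj.
- exact: slope_embed_continuous.
- move=> U oU; exists (j @` U); first exact: slope_embed_open.
  by rewrite setIidl // => _ [q _ <-]; exists q.
have jP x s : range j (Spt (i x) s).
  by exists (x, s * p x) => //; rewrite /slope_embed /= mulfK // gt_eqF.
(* The line over the single point [x0] already accumulates at both poles. *)
rewrite -subTset => -[w s|b] _ U; last first.
  case=> _ /filter_ex[s Hs].
  by exists (Spt (i x0) (sgn b * s)); split; [exact: jP|exact: Hs].
rewrite nbhs_spt => -[[A B] /= [Aw Bs] AB].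
have : closure (range i) w by rewrite dense_i.
move=> /(_ _ Aw)[_ [[x _ <-] Ax]].
exists (Spt (i x) s); split; first exact: jP.
by apply: (AB (i x, s)); split => //; exact: nbhs_singleton.
Qed.

Lemma remainder_slope_embed_pole b : remainder j (Pole b).
Proof. by case. Qed.

Lemma remainder_slope_embed_spt w s : remainder j (Spt w s) <-> remainder i w.
Proof.
split => h.
  move=> [x _ xw]; apply: h; exists (x, s * p x) => //.
  by rewrite /slope_embed /= mulfK ?gt_eqF // xw.
by move=> [[x r] _ [xw _]]; apply: h; exists x.
Qed.

Lemma closed_remainder_slope_embed : closed (remainder j).
Proof. by apply/open_closedC; apply: slope_embed_open; exact: openT. Qed.

(** * The remainder as the suspension of the boundary *)

Definition einf (b : bool) : \bar R := if b then +oo%E else -oo%E.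

Lemma cvg_sgn_einf b : (sgn b * s)%:E @[s --> +oo] --> einf b.
Proof.
case: b => A [M [Mr AM]]; exists `|M|.
  split; first exact: num_real.
  by move=> s Ms; apply: AM; rewrite /sgn mul1r lte_fin (le_lt_trans (ler_norm M)).
split; first exact: num_real.
move=> s Ms; apply: AM; rewrite /sgn mulN1r lte_fin ltrNl.
by rewrite (le_lt_trans _ Ms) // -normrN ler_norm.
Qed.

Definition susp_quot (u : Xb * \bar R) : W :=
  match u.2 with
  | r%:E => Spt u.1 r
  | +oo => Pole true
  | -oo => Pole false
  end%E.

Lemma susp_quot_einf z b : susp_quot (z, einf b) = Pole b.
Proof. by case: b. Qed.

Lemma susp_quot_continuous : continuous susp_quot.
Proof.
move=> [z e] U; rewrite /susp_quot /=; case: e => [r||] /=.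
- rewrite nbhs_spt => -[[A B] /= [Az Br] AB].
  exists (A, EFin @` B) => /=.
    by split => //; rewrite /nbhs /=; apply: filterS Br => t; exists t.
  by move=> [w e] /= [Aw [t Bt <-]]; exact: (AB (w, t)).
- move=> [Up [M [Mr UM]]].
  exists (setT, [set e | M%:E < e]%E) => /=.
    by split; [exact: filterT|exists M].
  move=> [w [t||]] /= [_ Mt] //.
  by move: Mt; rewrite lte_fin => Mt; have := UM t Mt w; rewrite /sgn mul1r.
- move=> [Up [M [Mr UM]]].
  exists (setT, [set e | e < (- M)%:E]%E) => /=.
    by split; [exact: filterT|exists (- M); split => //; exact: num_real].
  move=> [w [t||]] /= [_ Mt] //.
  move: Mt; rewrite lte_fin ltrNr => Mt.
  by have := UM _ Mt w; rewrite /sgn mulN1r opprK.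
Qed.

Lemma remainder_slope_embed_suspension :
  homeomorphic_to_suspension (R := R) (remainder i) (remainder j).
Proof.
case: icomp => -[cXb hXb iinj icont irel] _.
have qB z e : remainder i z -> remainder j (susp_quot (z, e)).
  by case: e => [r||] zi; [apply/remainder_slope_embed_spt| |];
    try exact: remainder_slope_embed_pole.
exists susp_quot, (Pole true), (Pole false); split; split => //.
- exact: remainder_slope_embed_pole.
- exact: remainder_slope_embed_pole.
- move=> [w s /remainder_slope_embed_spt wi|[] _]; [|by left|by right; left].
  by right; right; exists w => //; exists s.
- by move=> z z' r r' _ _ [].
move=> A AB; split => [[P oP AP]|[P oP AP]].
  exists (susp_quot @^-1` P).
    by apply: open_comp => // u _; exact: susp_quot_continuous.
  have := AP; rewrite !predeqE => AP' -[z e]; have := AP' (susp_quot (z, e)).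
  by rewrite /=; split => -[h [/= iz _]]; split => //; apply AP'; split => //;
    exact: qB.
(* Compactness serves at the poles: it turns neighbourhoods of the points [(w, einf b)] into one
   threshold valid over the whole boundary. *)
have cZ : compact (remainder i).
  by apply: (subclosed_compact _ cXb) => //; exact: open_closedC.
have APE z e : remainder i z -> A (susp_quot (z, e)) <-> P (z, e).
  move=> iz; move: AP; rewrite predeqE => /(_ (z, e)) [h1 h2].
  by split=> h; [have [] := h1 (conj h (conj iz Logic.I))
                |have [] := h2 (conj h (conj iz Logic.I))].
(* This is the largest open set whose trace on the remainder lies in [A]; it remains to see that it
   contains [A]. *)
exists [set v | remainder j v -> A v]°; first exact: open_interior.
apply/seteqP; split => v [] => [Av Bv|/interior_subset /= vA Bv]; split => //;
  last exact: vA.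
case: v Av Bv => [w s|b] Av /=.
  move=> /remainder_slope_embed_spt iw.
  have Pws : nbhs (w, s%:E) P by apply: open_nbhs_nbhs; split => //; apply/APE.
  rewrite /interior /= nbhs_spt.
  have h : (u.1, u.2%:E) @[u --> (w, s)] --> (w, s%:E).
    apply: cvg_pairT; first exact: cvg_fst.
    by apply: cvg_EFin; [exact: nearW|exact: cvg_snd].
  have hP : nbhs (w, s) [set u | P (u.1, u.2%:E)] := h _ Pws.
  apply: filterS hP => -[w' s'] /= Pw' /remainder_slope_embed_spt iw'.
  exact/(APE w' s'%:E).
move=> _; split => //.
have : \forall s \near +oo, remainder i `<=` (fun w => P (w, (sgn b * s)%:E)).
  move/compact_near_coveringP: cZ; apply => w iw.
  have : nbhs (w, einf b) P.
    by apply: open_nbhs_nbhs; split => //; apply/APE => //; rewrite susp_quot_einf.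
  move=> [[C D] /= [Cw Db] CDP].
  exists (C, [set s | D (sgn b * s)%:E]) => /=.
    by split => //; exact: (@cvg_sgn_einf b).
  by move=> [w' s'] /= [Cw' Ds']; exact: (CDP (_, _)).
apply: filterS => s Hs w /remainder_slope_embed_spt iw.
exact/(APE w (sgn b * s)%:E)/Hs.
Qed.

End suspension_compactification.

(** * Pushing the suspension off its boundary *)

Section clamp.
Context {R : realType}.

(** Precomposing with this retraction extends a homotopy to all real times, so that continuity holds
    on full products instead of subspaces. *)
Definition clamp (t : R) : R := Num.min 1 (Num.max 0 t).

Variant clamp_spec (t : R) : R -> Prop :=
| ClampLow of t <= 0 : clamp_spec t 0
| ClampMid of 0 < t & t < 1 : clamp_spec t t
| ClampHigh of 1 <= t : clamp_spec t 1.

Lemma clampP t : clamp_spec t (clamp t).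
Proof.
rewrite /clamp; have [t0|t0] := leP t 0.
  by rewrite min_r //; exact: ClampLow.
by have [t1|t1] := leP 1 t; [exact: ClampHigh|exact: ClampMid].
Qed.

Lemma clamp_ge0 t : 0 <= clamp t.
Proof. by case: (clampP t) => //; lra. Qed.

Lemma clamp_le1 t : clamp t <= 1.
Proof. by case: (clampP t) => //; lra. Qed.

Lemma clamp_id t : 0 <= t <= 1 -> clamp t = t.
Proof. by case: (clampP t); lra. Qed.

Lemma clamp_le0 t : t <= 0 -> clamp t = 0.
Proof. by case: (clampP t); lra. Qed.

Lemma clamp_ge1 t : 1 <= t -> clamp t = 1.
Proof. by case: (clampP t); lra. Qed.

Lemma clamp_continuous : continuous clamp.
Proof.
move=> t; apply/cvgrPdist_lt => r r0.
have : \forall s \near t, `|t - s| < r by exact: nbhsx_ballx.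
apply: filterS => s; rewrite !ltr_norml.
by case: (clampP t); case: (clampP s); lra.
Qed.

Lemma within_continuous_clamp {T U : topologicalType} (f : T * R -> U) :
  {within [set: T] `*` `[0, 1]%classic, continuous f} ->
  continuous (fun q => f (q.1, clamp q.2)).
Proof.
move=> /subspace_continuousP fc [x t] V /= Vf.
have D q : ([set: T] `*` `[0, 1]%classic) (q.1, clamp q.2).
  by split => //=; rewrite in_itv /= clamp_ge0 clamp_le1.
have /= := fc _ (D (x, t)) _ Vf; rewrite /within /= => nV.
have h : (q.1, clamp q.2) @[q --> (x, t)] --> (x, clamp t).
  apply: cvg_pairT; first exact: cvg_fst.
  by apply: continuous_cvg; [exact: clamp_continuous|exact: cvg_snd].
have : nbhs (x, t) [set q | ([set: T] `*` `[0, 1]%classic) (q.1, clamp q.2) ->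
  V (f (q.1, clamp q.2))] by exact: h _ nV.
rewrite /= nbhs_simpl /=.
by apply: filterS => q /=; apply; exact: D.
Qed.

End clamp.

Lemma fst_continuous {U V : topologicalType} : continuous (@fst U V).
Proof. by move=> q; exact: cvg_fst. Qed.

Lemma snd_continuous {U V : topologicalType} : continuous (@snd U V).
Proof. by move=> q; exact: cvg_snd. Qed.

Section suspension_homotopy.
Context {R : realType} {X Xb : topologicalType} (i : X -> Xb) (x1 : X).
Hypothesis iinj : injective i.
Hypothesis icont : continuous i.
Hypothesis iopen : open (range i).
Hypothesis irel : forall U : set X, open U ->
  exists2 O : set Xb, open O & i @` U = O `&` range i.
Variables (push : Xb -> R -> Xb) (contr : X -> R -> X).
Hypothesis push_cont : continuous (fun q : Xb * R => push q.1 q.2).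
Hypothesis push0 : forall w (t : R), t <= 0 -> push w t = w.
Hypothesis push_range : forall w (t : R), 0 < t -> range i (push w t).
Hypothesis contr_cont : continuous (fun q : X * R => contr q.1 q.2).
Hypothesis contr0 : forall x (s : R), s <= 0 -> contr x s = x.
Hypothesis contr1 : forall x (s : R), 1 <= s -> contr x s = x1.
Local Notation W := (susp Xb R).

(** First push into [X], then contract there; the contraction is complete once [clamp t * |s|]
    reaches 2. The first branch keeps [left_inv] away from time zero, where [push w t] may lie on
    the boundary. *)
Definition base_homotopy (w : Xb) (s t : R) : Xb :=
  if clamp t * `|s| <= 1 then push w t
  else i (contr (left_inv i x1 (push w t)) (clamp t * `|s| - 1)).

(** At positive time the absolute value stays below [1 / clamp t], and this bound is the limit at
    the poles. *)
Definition slope_homotopy (s t : R) : R := s / (1 + clamp t * `|s|).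

(* Near a pole the first coordinate is already contracted to [x1], which makes
   the homotopy well defined on the collapsed copies of [Xb]. *)
Definition susp_homotopy (q : W * R) : W :=
  match q.1 with
  | Spt w s => Spt (base_homotopy w s q.2) (slope_homotopy s q.2)
  | Pole b => if clamp q.2 == 0 then Pole b else Spt (i x1) (sgn b / clamp q.2)
  end.

Lemma clamp_gt0 (t : R) : 0 < clamp t -> 0 < t.
Proof. by case: (clampP t) => //; lra. Qed.

Lemma base_homotopyE w s t : 0 < clamp t -> base_homotopy w s t =
  i (contr (left_inv i x1 (push w t)) (clamp t * `|s| - 1)).
Proof.
move=> t0; rewrite /base_homotopy; case: ifPn => // ts.
by rewrite contr0 ?left_inv_range //; [exact/push_range/clamp_gt0|lra].
Qed.

(** Where [clamp t * |s| < 1] the first branch holds nearby. Otherwise [clamp t] is positive, and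
    near such a point the second formula is valid throughout, since the contraction is the identity
    at nonpositive times. *)
Lemma base_homotopy_continuous :
  continuous (fun u : (Xb * R) * R => base_homotopy u.1.1 u.1.2 u.2).
Proof.
move=> [[w s] t].
have cw : u.1.1 @[u --> (w, s, t)] --> w.
  exact: (continuous_comp (@fst_continuous _ _ (w, s, t))
    (@fst_continuous _ _ (w, s))).
have cs : u.1.2 @[u --> (w, s, t)] --> s.
  exact: (continuous_comp (@fst_continuous _ _ (w, s, t))
    (@snd_continuous _ _ (w, s))).
have ct : u.2 @[u --> (w, s, t)] --> t by exact: cvg_snd.
have cct : clamp u.2 @[u --> (w, s, t)] --> clamp t.
  by apply: continuous_cvg; [exact: clamp_continuous|].
have cm : clamp u.2 * `|u.1.2| @[u --> (w, s, t)] --> clamp t * `|s|.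
  by apply: cvgM => //; apply: cvg_norm.
have cp : push u.1.1 u.2 @[u --> (w, s, t)] --> push w t.
  have cwt : (u.1.1, u.2) @[u --> (w, s, t)] --> (w, t) by exact: cvg_pairT.
  exact: (continuous_cvg _ (@push_cont (w, t)) cwt).
have [ts1|ts1] := ltP (clamp t * `|s|) 1.
  have ne : \forall u \near (w, s, t), clamp u.2 * `|u.1.2| < 1.
    by move/cvgr_lt: cm; apply.
  rewrite /continuous_at /=; have -> : base_homotopy w s t = push w t.
    by rewrite /base_homotopy /= ltW.
  apply: cvg_trans cp; apply: near_eq_cvg.
  by apply: filterS ne => u /ltW; rewrite /base_homotopy => ->.
have t0 : 0 < clamp t.
  rewrite lt_neqAle clamp_ge0 andbT; apply/eqP => t0.
  by move: ts1; rewrite -t0 mul0r ler10.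
have ne : \forall u \near (w, s, t), 0 < clamp u.2.
  by move/cvgr_gt: cct; apply.
rewrite /continuous_at /= base_homotopyE //.
suff h : i (contr (left_inv i x1 (push u.1.1 u.2)) (clamp u.2 * `|u.1.2| - 1))
    @[u --> (w, s, t)] -->
    i (contr (left_inv i x1 (push w t)) (clamp t * `|s| - 1)).
  apply: cvg_trans h; apply: near_eq_cvg.
  by apply: filterS ne => u u0; rewrite base_homotopyE.
apply: continuous_cvg; first exact: icont.
have cl : left_inv i x1 (push u.1.1 u.2) @[u --> (w, s, t)] -->
    left_inv i x1 (push w t).
  apply: continuous_cvg => //; apply: left_inv_continuous => //.
  exact/push_range/clamp_gt0.
have cm1 : clamp u.2 * `|u.1.2| - 1 @[u --> (w, s, t)] --> clamp t * `|s| - 1.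
  by apply: cvgB => //; exact: cvg_cst.
have clm : (left_inv i x1 (push u.1.1 u.2), clamp u.2 * `|u.1.2| - 1)
    @[u --> (w, s, t)] -->
  (left_inv i x1 (push w t), clamp t * `|s| - 1) by exact: cvg_pairT.
exact: (continuous_cvg _ (@contr_cont (_, _)) clm).
Qed.

Lemma slope_homotopy_continuous :
  continuous (fun u : R * R => slope_homotopy u.1 u.2).
Proof.
move=> [s t]; rewrite /slope_homotopy /=.
apply: cvgM; first exact: cvg_fst.
apply: cvgV.
  by rewrite gt_eqF // ltr_pwDl // mulr_ge0 // clamp_ge0.
apply: cvgD; first exact: cvg_cst.
apply: cvgM; last by apply: cvg_norm; exact: cvg_fst.
by apply: continuous_cvg; [exact: clamp_continuous|exact: cvg_snd].
Qed.

Lemma nbhs_pole_gt b (K : R) : nbhs (Pole b : W)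
  [set v | match v with Spt _ s => K < sgn b * s | Pole b' => b' = b end].
Proof.
split => //; near=> s => w /=; rewrite sgn_mulK; near: s.
by apply: nbhs_pinfty_gt; rewrite num_real.
Unshelve. all: by end_near. Qed.

Lemma slope_homotopy_sgn b (s t : R) : 0 < sgn b * s -> slope_homotopy s t =
  sgn b * ((sgn b * s) / (1 + clamp t * (sgn b * s))).
Proof.
move=> s0; rewrite /slope_homotopy mulrA sgn_mulK; congr (_ / (_ + _ * _)).
by rewrite -(normr_sgn b) gtr0_norm.
Qed.

Lemma slope_homotopy_cvg_pole (t : R) : 0 < clamp t ->
  u.1 / (1 + clamp u.2 * u.1) @[u --> filter_prod (pinfty_nbhs R) (nbhs t)]
    --> (clamp t)^-1.
Proof.
move=> t0.
have cct : clamp u.2 @[u --> filter_prod (pinfty_nbhs R) (nbhs t)]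
    --> clamp t.
  by apply: continuous_cvg; [exact: clamp_continuous|exact: cvg_snd].
have ci : u.1^-1 @[u --> filter_prod (pinfty_nbhs R) (nbhs t)]
    --> (0 : R).
  have h : s^-1 @[s --> +oo] --> (0 : R).
    by apply/gtr0_cvgV0; [exact: nbhs_pinfty_gt|exact: cvg_id].
  exact: (cvg_comp _ _ cvg_fst h).
(* Numerator and denominator are divided by the coordinate, whose inverse tends to zero. *)
have : (u.1^-1 + clamp u.2)^-1 @[u --> filter_prod (pinfty_nbhs R) (nbhs t)]
    --> (clamp t)^-1.
  apply: cvgV; first by rewrite gt_eqF.
  by rewrite -[X in _ --> X]add0r; apply: cvgD.
apply: cvg_trans; apply: near_eq_cvg.
exists ([set s | 0 < s], setT) => /=.
  by split; [exact: nbhs_pinfty_gt|exact: filterT].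
move=> [s t'] /= [s0 _].
have : 1 + clamp t' * s != 0.
  by rewrite gt_eqF // ltr_pwDl // mulr_ge0 ?clamp_ge0 // ltW.
have : s != 0 by rewrite gt_eqF.
move=> s1 s2.
rewrite -[X in _ / X](_ : s * (s^-1 + clamp t') = _); last first.
  by rewrite mulrDr divff // (mulrC s).
by rewrite invfM mulrA divff // mul1r.
Qed.

Lemma susp_homotopy_continuous : continuous susp_homotopy.
Proof.
move=> [[w s|b] t] U; rewrite /susp_homotopy /=.
  move=> Uws.
  have h : spt (base_homotopy u.1.1 u.1.2 u.2, slope_homotopy u.1.2 u.2)
      @[u --> (w, s, t)] --> spt (base_homotopy w s t, slope_homotopy s t).
    apply: continuous_cvg; first exact: spt_continuous.
    apply: cvg_pairT; first exact: (@base_homotopy_continuous (w, s, t)).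
    have cs : u.1.2 @[u --> (w, s, t)] --> s.
      exact: (continuous_comp (@fst_continuous _ _ (w, s, t))
    (@snd_continuous _ _ (w, s))).
    have cst : (u.1.2, u.2) @[u --> (w, s, t)] --> (s, t).
      by apply: cvg_pairT => //; exact: cvg_snd.
    exact: (continuous_cvg _ (@slope_homotopy_continuous (s, t)) cst).
  have [[B C] /= [Bws Ct] BCU] := h _ Uws.
  exists (spt @` B, C) => /=.
    by split => //; rewrite nbhs_spt; apply: filterS Bws => u; exists u.
  by move=> [_ t'] /= [[[w' s'] Bw' <-] Ct']; exact: (BCU (w', s', t')).
case: ifPn => [/eqP t0|t0].
  move=> [Ub [M0 [_ UM0]]].
  pose M := Num.max 1 M0.
  have M1 : 1 <= M by rewrite le_max lexx.
  have UM s w : M < sgn b * s -> U (Spt w s).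
    rewrite gt_max => /andP[_ h]; rewrite -(sgn_mulK b s); exact: UM0.
  have M2 : 0 < (2 * M)^-1 by rewrite invr_gt0; lra.
  (* At a pole at time zero: [r > 2 * M] and [clamp t' < 1 / (2 * M)] give
     [M * (1 + clamp t' * r) <= M + r / 2 < r], so the new slope still exceeds [M]. *)
  exists ([set v | match v with
    Spt _ s => 2 * M < sgn b * s | Pole b' => b' = b end],
    [set t' | clamp t' < (2 * M)^-1]) => /=.
    split; first exact: nbhs_pole_gt.
    by have /cvgr_lt := @clamp_continuous R t; apply; rewrite t0.
  have MM : M * (2 * M)^-1 = 2^-1 by field; lra.
  move=> [[w s|b'] t'] /= [sM t'M].
    apply: UM; rewrite (slope_homotopy_sgn (b := b)); last lra.
    rewrite sgn_mulK; set r := sgn b * s in sM *.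
    have h : M * clamp t' <= 2^-1 by rewrite -MM ler_wpM2l ?ltW //; lra.
    have h2 : M * clamp t' * r <= 2^-1 * r by rewrite ler_wpM2r //; lra.
    have c0 : 0 <= clamp t' * r by rewrite mulr_ge0 ?clamp_ge0 //; lra.
    rewrite ltr_pdivlMr; last lra.
    by rewrite mulrDr mulr1 mulrA; lra.
  rewrite sM; case: ifPn => // t'0; apply: UM.
  have ct0 : 0 < clamp t' by rewrite lt_neqAle eq_sym t'0 clamp_ge0.
  rewrite sgn_mulK.
  have : 2 * M < (clamp t')^-1 by rewrite -[2 * M]invrK ltf_pV2 // posrE.
  lra.
have ct : 0 < clamp t by rewrite lt_neqAle eq_sym t0 clamp_ge0.
rewrite nbhs_spt => -[[B C] /= [Bx Cs] BCU].
have hs : sgn b * (u.1 / (1 + clamp u.2 * u.1)) @[u --> filter_prod (pinfty_nbhs R) (nbhs t)]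
    -->
    sgn b / clamp t.
  by apply: cvgM; [exact: cvg_cst|exact: slope_homotopy_cvg_pole].
have [[D E] /= [[K [_ KD]] Et] DE] := hs _ Cs.
have ht : sgn b / clamp t' @[t' --> t] --> sgn b / clamp t.
  apply: cvgM; first exact: cvg_cst.
  by apply: cvgV; [exact: t0|exact: clamp_continuous].
have Ct := ht _ Cs.
pose r := clamp t / 2.
have r0 : 0 < r by rewrite divr_gt0.
have rt : \forall t' \near t, r < clamp t'.
  have /cvgr_gt := @clamp_continuous R t; apply; rewrite /r.
  by rewrite ltr_pdivrMr //; lra.
have t'B t' : r < clamp t' -> B (i x1) by move=> _; exact: nbhs_singleton.
(* Beyond [2 / r] the contraction is complete, so the base point is exactly [i x1]; beyond [K] the
   slope is close to its limit. *)
pose L := Num.max (Num.max 0 K) (2 / r).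
exists ([set v | match v with
    Spt _ s => L < sgn b * s | Pole b' => b' = b end],
    [set t' | [/\ E t', C (sgn b / clamp t') & r < clamp t']]) => /=.
  split; first exact: nbhs_pole_gt.
  by apply: filterS3 Et Ct rt => t' *; split.
move=> [[w s|b'] t'] /= [sL [Et' Ct' rt']].
  move: sL; rewrite !gt_max => /andP[/andP[s0 sK] sr].
  have ct' : 0 < clamp t' := lt_trans r0 rt'.
  rewrite base_homotopyE // contr1; last first.
    rewrite -(normr_sgn b) gtr0_norm // lerBrDr.
    move: sr; rewrite ltr_pdivrMr // => sr.
    apply: ltW; apply: lt_trans (_ : r * (sgn b * s) < _); last first.
      by rewrite ltr_pM2r.
    by rewrite mulrC; lra.
  apply: (BCU (i x1, slope_homotopy s t')); split; first exact: t'B rt'.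
  rewrite /= (slope_homotopy_sgn (b := b)) //.
  by apply: (DE (sgn b * s, t')); split => //=; exact: KD.
rewrite sL gt_eqF ?(lt_trans r0) //.
by apply: (BCU (i x1, _)); split => //=; exact: t'B rt'.
Qed.

Lemma susp_homotopy0 v : susp_homotopy (v, 0) = v.
Proof.
have c0 : clamp 0 = 0 :> R by rewrite clamp_id // lexx ler01.
case: v => [w s|b]; rewrite /susp_homotopy /= ?c0 ?eqxx //.
by rewrite /base_homotopy /slope_homotopy c0 !mul0r ler01 addr0 divr1 push0.
Qed.

Lemma susp_homotopy_range v t : 0 < t <= 1 ->
  exists x s, susp_homotopy (v, t) = Spt (i x) s.
Proof.
move=> /andP[t0 t1]; have ct : clamp t = t by rewrite clamp_id // t1 ltW.
case: v => [w s|b]; rewrite /susp_homotopy /=.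
  by rewrite base_homotopyE ?ct //; do 2 eexists.
by rewrite ct gt_eqF //; do 2 eexists.
Qed.

End suspension_homotopy.

(** * Boxes are small at infinity *)

Section box_control.
Context {R : realType} {X Xb : topologicalType} (d : X -> X -> R) (i : X -> Xb)
  (x1 : X) (eta : R -> R) (beta : nat -> Xb -> X).
Hypothesis dprop : proper_metric d.
Hypothesis Xb_compact : compact [set: Xb].
Hypothesis beta_cont : forall m, continuous (beta m).
Hypothesis beta_sep : forall a b, (forall m, beta m a = beta m b) -> a = b.
Hypothesis eta_ge0 : forall r, 0 <= r -> 0 <= eta r.
Hypothesis eta_mono : forall r s, 0 <= r -> r <= s -> eta r <= eta s.

(** If a box contains a point of slope at most [n] where the weight is below [n + 1], then
    [|k| <= n * (n + 1) + 1 <= (n + 2) ^ 2], so this bounds its radius. *)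
Definition box_radius (n : nat) : R := eta (n.+2%:R ^+ 2).

Lemma box_radius_ge0 n : 0 <= box_radius n.
Proof. by apply: eta_ge0; rewrite exprn_ge0. Qed.

(** Control is applied to the [n]-th closeness cover and the compact set enlarged to a ball about
    [x1]. The extra 1 leaves room for the strict diameter bound. *)
Lemma controlled_outside_ball : controlled d i -> exists c : nat -> R, forall n,
  0 <= c n /\ forall A : set X, (forall y, A y -> c n < d x1 y) ->
    diam_lt d A (2 * box_radius n + 1) ->
    exists2 V, close_cover d beta n V & i @` A `<=` V.
Proof.
move=> ctrl; pose P n (a : R) := 0 <= a /\ forall A : set X,
  (forall y, A y -> a < d x1 y) -> diam_lt d A (2 * box_radius n + 1) ->
  exists2 V, close_cover d beta n V & i @` A `<=` V.
suff /boolp.choice[f fP] : forall n, exists a, P n a by exists f.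
move=> n; rewrite /P.
have r0 : 0 < 2 * box_radius n + 1 by have := box_radius_ge0 n; lra.
have [C cC CP] := ctrl _ _ r0 (open_close_cover dprop.1 beta_cont n).
have [c c0 cb] := compact_dist_bounded dprop.1 x1 cC.
exists c; split => // A Ac; apply: CP => y /Ac cy Cy.
by move: cy; rewrite ltNge cb.
Qed.

Variable c : nat -> R.
Hypothesis c_ge0 : forall n, 0 <= c n.
Hypothesis c_control : forall n (A : set X), (forall y, A y -> c n < d x1 y) ->
  diam_lt d A (2 * box_radius n + 1) ->
  exists2 V, close_cover d beta n V & i @` A `<=` V.

(** Large enough to cover a move across a box and, as a lower bound for distances to [x1], to keep
    the box off the ball of radius [c n]. *)
Definition slow_rate (n : nat) : R := 2 * box_radius n + c n + 1.

Definition slow_weight (x : X) : R := slow slow_rate (d x1 x).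

Local Notation p := slow_weight.

Lemma slow_weight_gt0 x : 0 < p x.
Proof. by apply: lt_le_trans (slow_ge1 _ _). Qed.

Lemma slow_weight_continuous : continuous p.
Proof.
move=> x; apply/cvgrPdist_lt => r r0.
apply: filterS (near_dist_lt dprop.1 x r0) => y; apply: le_lt_trans.
apply: le_trans (slow_lipschitz _ _ _) _; exact: ler_dist_dist dprop.1 _ _ _.
Qed.

(** * A box containing a point [(y, r)] of slope at most [M] *)

Section box.
Variables (k : int) (x y : X) (r M : R) (n : nat).
Hypothesis M_ge1 : 1 <= M.
Hypothesis xy : d x y <= eta `|k|%:~R.
Hypothesis kr : k%:~R <= r <= k%:~R + 1.
Hypothesis rM : `|r| <= M * p y.
Hypothesis Mn : M <= n%:R.
Hypothesis n3 : (3 <= n)%N.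
Hypothesis pn : n%:R <= p y < n.+1%:R.

Lemma box_radius_bound : eta `|k|%:~R <= box_radius n.
Proof.
apply: eta_mono; first by rewrite ler0z.
rewrite intr_norm.
have e1 : n.+1%:R = n%:R + 1 :> R by rewrite -natr1.
have e2 : n.+2%:R = n%:R + 2 :> R by rewrite -natr1 e1; lra.
have n0 : 0 <= n%:R :> R by [].
have h1 : M * p y <= n%:R * (n%:R + 1).
  move: pn; rewrite e1 => /andP[_ /ltW pn1].
  by apply: ler_pM => //; [exact: le_trans ler01 M_ge1|exact/ltW/slow_weight_gt0].
have h2 : `|k%:~R : R| <= `|r| + 1.
  have := ler_norm r; have := ler_norm (- r); rewrite normrN.
  by have := kr; rewrite ler_norml; lra.
apply: le_trans h2 _; rewrite e2 expr2.
have := rM; move: h1 n0; move: (n%:R : R) (M * p y) => a b h1 a0 h.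
have := le_trans h h1; nra.
Qed.

Lemma box_variation y' : d x y' <= eta `|k|%:~R ->
  `|p y' - p y| <= 2 /\ c n < d x1 y'.
Proof.
case: dprop => -[d0 dE dC dT dop] _ xy'.
have yy' : d y y' <= 2 * box_radius n.
  by have := xy; have := box_radius_bound; have := dT y x y'; rewrite (dC y x); lra.
have [|pp gt] := slow_variation (t' := d x1 y') n3 pn.
  have := ler_dist_dist dprop.1 x1 y' y; rewrite (dC y').
  by rewrite /slow_rate; have := c_ge0 n; lra.
by split => //; move: gt; rewrite /slow_rate; have := box_radius_ge0 n; lra.
Qed.

(** The whole ball avoids the ball of radius [c n] and has diameter at most [2 * box_radius n], so
    one member of the [n]-th closeness cover contains its image. *)
Lemma box_close y' : d x y' <= eta `|k|%:~R -> close d beta n (i y) (i y').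
Proof.
case: dprop => -[d0 dE dC dT dop] _ xy'.
have [| |V [_ VC] iV] := @c_control n (cball d x (eta `|k|%:~R)).
- by move=> z /box_variation[].
- exists (2 * box_radius n); first lra.
  move=> a b xa xb; have := box_radius_bound; have := dT a x b.
  by move: xa xb; rewrite (dC a x) /cball /=; lra.
- by apply: VC; apply: iV; [exists y|exists y'].
Qed.

Lemma box_slope y' r' : d x y' <= eta `|k|%:~R ->
  k%:~R <= r' <= k%:~R + 1 -> `|r / p y - r' / p y'| <= (1 + 2 * M) / p y'.
Proof.
move=> /box_variation[pp _] kr'.
have p0 := slow_weight_gt0 y; have p0' := slow_weight_gt0 y'.
have -> : r / p y - r' / p y' = ((r - r') + (r / p y) * (p y' - p y)) / p y'.
  (* In the numerator, the heights differ by at most 1, and a slope of at most [M] multiplies a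
     weight change of at most 2. *)
  by field; rewrite !gt_eqF.
rewrite normrM normfV (gtr0_norm p0') ler_pM2r ?invr_gt0 //.
apply: le_trans (ler_normD _ _) _; apply: lerD.
  by have := kr; rewrite ler_norml; lra.
rewrite normrM mulrC ler_pM //.
by rewrite normrM normfV (gtr0_norm p0) ler_pdivrMr.
Qed.

End box.

Lemma box_control (U : set (set (susp Xb R))) : open_cover U ->
  exists (Q : set X) (N : R), [/\ compact Q, 0 < N &
    forall (k : int) (x : X),
      let S := cball d x (eta `|k|%:~R) `*` `[k%:~R, k%:~R + 1]%classic in
      S `&` (Q `*` `[- N, N]%classic) = set0 ->
      exists2 V, U V & slope_embed i p @` S `<=` V].
Proof.
move=> Ucov; have [Uo Uc] := Ucov.
have pole b : exists2 V, U V & \forall M \near +oo,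
    forall w s, M < sgn b * s -> V (Spt w s).
  have [V UV Vb] : (\bigcup_(V in U) V) (Pole b) by rewrite Uc.
  exists V => //.
  have : nbhs (Pole b) V by apply: open_nbhs_nbhs; split => //; exact: Uo.
  move=> [_ [M [Mr VM]]]; exists M; split => // M' MM' w s M's.
  by rewrite -(sgn_mulK b s); apply: VM; exact: lt_trans M's.
have [Vt UVt Mt] := pole true; have [Vf UVf Mf] := pole false.
(* Beyond slope [M] on either side, all points lie in the members of [U] chosen at the poles. *)
have [M [[M1 VtM] VfM]] := filter_ex (filterI (filterI
  (nbhs_pinfty_ge (num_real (1 : R))) Mt) Mf).
have [n0 n0P] := filter_ex (close_refines dprop.1 beta_cont beta_sep
  Xb_compact M Ucov).
(* The last bound gives [p y' >= K - 2 > (1 + 2 * M) * (n0 + 1)], which brings the slope variation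
   below [1 / (n0 + 1)]. *)
have [K [[K3 Kn0] [KM Kn]]] := filter_ex (filterI
  (filterI (nbhs_infty_ge 3) (nbhs_infty_ge n0))
  (filterI (nbhs_infty_ger M) (nbhs_infty_ger ((1 + 2 * M) * n0.+1%:R + 3)))).
rewrite /= in KM Kn.
have K0 : 0 <= K%:R :> R by [].
(* The ball contains all points of weight at most [K], over which slope at most [M] means height at
   most [M * K]. A point of slope at most [M] outside this product thus has weight at least [K]. *)
exists (cball d x1 (breakpoint slow_rate K + K.+1%:R)), (M * K%:R + 1).
split; first exact: dprop.2.
  by rewrite ltr_pwDr // mulr_ge0 //; lra.
move=> k x S SQ.
have [[[y r] [/= xy kr] rM]|noflat] :=
    pselect (exists2 q, S q & `|q.2| <= M * p q.1).
  move: kr; rewrite in_itv /= => kr.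
  have py : K%:R <= p y.
    rewrite leNgt; apply/negP => pK.
    suff : (S `&` (cball d x1 (breakpoint slow_rate K + K.+1%:R) `*`
        `[- (M * K%:R + 1), (M * K%:R + 1)]%classic)) (y, r) by rewrite SQ.
    split; first by split => //=; rewrite in_itv.
    split; first by apply: slow_proper; exact: ltW.
    rewrite /= in_itv /= -ler_norml; apply: le_trans rM _.
    have : M * p y <= M * K%:R by rewrite ler_pM2l ?ltW //; lra.
    lra.
  pose n := Num.truncn (p y).
  have pn : n%:R <= p y < n.+1%:R.
    by apply: truncn_itv; exact/ltW/slow_weight_gt0.
  have Kn' : (K <= n)%N.
    by rewrite -ltnS -(ltr_nat R); case/andP: pn => _; exact: le_lt_trans.
  have Kn'R : K%:R <= n%:R :> R by rewrite ler_nat.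
  have Mn : M <= n%:R by exact: le_trans Kn'R.
  have n3 : (3 <= n)%N by exact: leq_trans Kn'.
  have slopeM : - M <= r / p y <= M.
    rewrite -ler_norml normrM normfV (gtr0_norm (slow_weight_gt0 y)).
    by rewrite ler_pdivrMr // slow_weight_gt0.
  have [V UV Vy] := n0P (i y) _ slopeM.
  exists V => // _ [[y' r'] [/= xy' kr'] <-].
  move: kr'; rewrite in_itv /= => kr'.
  apply: Vy => /=.
    move=> m mn0; have mn := leq_trans mn0 (leq_trans Kn0 Kn').
    apply: le_trans (box_close M1 xy kr rM Mn n3 pn xy' mn) _.
    by rewrite lef_pV2 ?posrE // ler_nat ltnS (leq_trans Kn0).
  apply: le_lt_trans (box_slope M1 xy kr rM Mn n3 pn xy' kr') _.
  have [pp _] := box_variation M1 xy kr rM Mn n3 pn xy'.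
  have p0' := slow_weight_gt0 y'.
  rewrite ltr_pdivrMr // [ltRHS]mulrC ltr_pdivlMr //.
  by case/andP: pn => pn1 _; move: pp; rewrite ler_norml; lra.
have steep q : S q -> M * p q.1 < `|q.2|.
  by move=> Sq; rewrite ltNge; apply/negP => h; apply: noflat; exists q.
(* The interval [[k, k + 1]] with integer ends lies on one side of zero, so a single pole serves the
   whole steep box. *)
have [k0|k0] := leP 0 k.
  exists Vt => // _ [[y r] Sq <-]; apply: VtM.
  have := steep _ Sq; case: Sq => /= _; rewrite in_itv /= => /andP[kr _].
  rewrite ger0_norm ?(le_trans _ kr) ?ler0z //.
  by rewrite /sgn mul1r ltr_pdivlMr // slow_weight_gt0.
exists Vf => // _ [[y r] Sq <-]; apply: VfM.
have := steep _ Sq; case: Sq => /= _; rewrite in_itv /= => /andP[_ kr].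
have r0 : r <= 0.
  apply: le_trans kr _; rewrite -[1]/(1%:~R) -intrD lerz0.
  by rewrite addrC lez1D.
rewrite ler0_norm //.
by rewrite /sgn mulN1r -mulNr ltr_pdivlMr // slow_weight_gt0.
Qed.

End box_control.

(** * Assembly of the compactification *)

Lemma push_sequence_separates {R : realType} {T : topologicalType}
    (push : T -> R -> T) (a b : T) : hausdorff_space T ->
  continuous (fun q : T * R => push q.1 q.2) -> (forall w, push w 0 = w) ->
  (forall m, push a m.+1%:R^-1 = push b m.+1%:R^-1) -> a = b.
Proof.
move=> hT push_cont push0 ab.
have h w : push w n.+1%:R^-1 @[n --> \oo] --> w.
  have hw : (w, n.+1%:R^-1 : R) @[n --> \oo] --> (w, 0 : R).
    by apply: cvg_pairT; [exact: cvg_cst|exact: cvg_harmonic].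
  rewrite -[X in _ --> X]push0.
  exact: (continuous_cvg _ (@push_cont (w, 0)) hw).
apply: (cvg_unique hT (h a)).
have -> : (fun n => push a n.+1%:R^-1) = (fun n => push b n.+1%:R^-1).
  by apply/funext.
exact: h.
Qed.

Unset Implicit Arguments.

Theorem mainTheorem9 (R : realType) (X Xb : topologicalType) (d : X -> X -> R)
    (i : X -> Xb) (eta : R -> R) :
  proper_metric d ->
  contractible (R := R) X ->
  is_Zcompactification (R := R) i ->
  controlled d i ->
  (forall r, 0 <= r -> 0 <= eta r) ->
  (forall r s, 0 <= r -> r <= s -> eta r <= eta s) ->
  eta x @[x --> +oo] --> +oo ->
  exists (W : topologicalType) (j : X * R -> W),
    [/\ is_Zcompactification (R := R) j,
        homeomorphic_to_suspension (R := R) (remainder i) (remainder j) &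
        forall U : set (set W), open_cover U ->
          exists (Q : set X) (N : R),
            [/\ compact Q, 0 < N &
              forall (k : int) (x : X),
                let S := cball d x (eta `|k|%:~R) `*` `[k%:~R, k%:~R + 1]%classic in
                S `&` (Q `*` `[- N, N]%classic) = set0 ->
                exists2 V, U V & j @` S `<=` V]].
Proof.
(* The end point [x1] of the contraction also serves as the centre for distances and as the default
   value of the inverse of [i]. *)
move=> dprop [H [Hc H0 [x1 H1]]] [icomp [iclosed [al [alc al0 alZ]]]] ctrl.
move=> eta0 eta_mono _.
have [[cXb hXb iinj icont irel] _] := icomp.
have iopen : open (range i) by rewrite -[range i]setCK; exact: closed_openC.
pose push w t := al (w, clamp t); pose contr x s := H (x, clamp s).
have push_cont : continuous (fun q : Xb * R => push q.1 q.2).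
  exact: within_continuous_clamp alc.
have contr_cont : continuous (fun q : X * R => contr q.1 q.2).
  exact: within_continuous_clamp Hc.
have push0 w t : t <= 0 -> push w t = w.
  by move=> t0; rewrite /push clamp_le0.
have push_range w t : 0 < t -> range i (push w t).
  move=> t0; apply: contrapT; apply: alZ.
  by case: (clampP t); lra.
have contr0 x s : s <= 0 -> contr x s = x.
  by move=> s0; rewrite /contr clamp_le0.
have contr1 x s : 1 <= s -> contr x s = x1.
  by move=> s1; rewrite /contr clamp_ge1.
pose beta m w := left_inv i x1 (push w m.+1%:R^-1).
have inv_gt0 m : 0 < m.+1%:R^-1 :> R by rewrite invr_gt0.
have beta_cont m : continuous (beta m).
  move=> w.
  have hw : (w', m.+1%:R^-1 : R) @[w' --> w] --> (w, m.+1%:R^-1 : R).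
    by apply: cvg_pairT; [exact: cvg_id|exact: cvg_cst].
  apply: continuous_cvg; first by apply: left_inv_continuous => //; exact: push_range.
  exact: (continuous_cvg _ (@push_cont (w, _)) hw).
have beta_sep a b : (forall m, beta m a = beta m b) -> a = b.
  move=> ab; apply: (push_sequence_separates (push := push)) => // [w|m].
    exact: push0.
  have r w : i (beta m w) = push w m.+1%:R^-1.
    by apply: left_inv_range; exact: push_range.
  by rewrite -!r ab.
have [c cP] := controlled_outside_ball x1 dprop beta_cont eta0 ctrl.
pose p := slow_weight d x1 eta c.
have p_gt0 x : 0 < p x by exact: slow_weight_gt0.
have p_cont : continuous p by exact: (@slow_weight_continuous _ _ _ _ _ dprop).
exists (susp Xb R), (slope_embed i p); split.
- split; first exact: slope_embed_compactification.
  split; first exact: closed_remainder_slope_embed.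
  exists (susp_homotopy i x1 push contr); split.
  + exact/continuous_subspaceT/susp_homotopy_continuous.
  + by move=> v; exact: susp_homotopy0.
  + move=> v t t01; have [x [s ->]] := susp_homotopy_range x1 push_range contr0 v t01.
    by move/remainder_slope_embed_spt; apply; [exact: p_gt0|exists x].
- exact: remainder_slope_embed_suspension.
- move=> U Ucov.
  exact: (box_control dprop cXb beta_cont beta_sep eta0 eta_mono
    (fun n => (cP n).1) (fun n => (cP n).2)).
Qed.
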